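(* Let $q$ be a power of an odd prime and let $m\geq 2$. Suppose that $q\equiv 1\pmod 4$ or that $m$ is even. Let $G$ be a solvable subgroup of $\mathrm{Sp}(2m,q)$ such that $q^m+1$ divides $|G|$. Then there is at least one Zsigmondy prime divisor $r$ of $q^{2m}-1$ such that a Sylow $r$-subgroup of $G$ is normal in $G$, unless possibly $q=3$ and $m=2$.
   Context: A prime $r$ is a Zsigmondy prime divisor of $q^i-1$ if $r$ divides $q^i-1$ but does not divide $q^j-1$ for any $1\leq j<i$. $\mathrm{Sp}(2m,q)$ denotes the isometry group of a non-degenerate alternating bilinear form on a $2m$-dimensional vector space over $\mathbb{F}_q$. *)

(* Defs.v *)
From HB Require Import structures.
From mathcomp Require Import all_boot all_order all_algebra all_fingroup all_solvable.
From mathcomp Require Import sesquilinear.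

Set Implicit Arguments.
Unset Strict Implicit.
Unset Printing Implicit Defensive.

Import GRing.Theory.
Local Open Scope ring_scope.

Definition zsigmondy_prime (q i r : nat) : Prop :=
  [/\ prime r, (r %| q ^ i - 1)%N
    & forall j : nat, (1 <= j < i)%N -> ~~ (r %| q ^ j - 1)%N].

Definition alternating (F : fieldType) (V : lmodType F) (B : {biscalar V}) : Prop :=
  forall u : V, B u u = 0.

(* One-sided: an alternating form is skew-symmetric, so its left and right
   radicals coincide. *)
Definition nondegenerate_form (F : fieldType) (V : lmodType F)
    (B : {biscalar V}) : Prop :=
  forall u : V, (forall v : V, B u v = 0) -> u = 0.

(* Matrices act on row vectors from the right.  The dimension is written
   n.-1.+1 because that is the size of the matrices in {'GL_n[F]}; it is equal
   to n for n > 0. *)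
Definition isometry_group (F : finFieldType) (n : nat)
    (B : {biscalar 'rV[F]_n.-1.+1}) : {set {'GL_n[F]}} :=
  [set g : {'GL_n[F]} |
    [forall u : 'rV[F]_n.-1.+1, forall v : 'rV[F]_n.-1.+1,
       B (u *m val g) (v *m val g) == B u v]].

Lemma isometry_groupP (F : finFieldType) (n : nat)
    (B : {biscalar 'rV[F]_n.-1.+1}) (g : {'GL_n[F]}) :
  reflect (forall u v, B (u *m val g) (v *m val g) = B u v)
          (g \in isometry_group B).
Proof.
rewrite inE; apply: (iffP forallP) => [gB u v | gB u].
  by have /forallP/(_ v)/eqP := gB u.
by apply/forallP => v; apply/eqP.
Qed.

Fact isometry_group_group_set (F : finFieldType) (n : nat)
    (B : {biscalar 'rV[F]_n.-1.+1}) : group_set (isometry_group B).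
Proof.
apply/group_setP; split=> [|g h /isometry_groupP gB /isometry_groupP hB].
  by apply/isometry_groupP => u v; rewrite !mulmx1.
by apply/isometry_groupP => u v; rewrite !mulmxA hB gB.
Qed.

Canonical isometry_group_group (F : finFieldType) (n : nat)
    (B : {biscalar 'rV[F]_n.-1.+1}) : {group {'GL_n[F]}} :=
  Group (isometry_group_group_set B).

(* Main.v *)
(* Let n = 2m, let r be a Zsigmondy prime of q^n - 1 and let R be a Sylow
   r-subgroup of G; R is nontrivial because r divides q^m + 1, and r >= n + 1
   because q has order n modulo r.  Counting fixed vectors shows that every
   nontrivial r-subgroup is irreducible; hence R is cyclic, the subgroup H of
   order r in R has an abelian centralizer, and R is normal in G as soon as H
   is.  Otherwise H acts nontrivially on O_s(G) for some prime s different from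
   r and from the characteristic.  On D = [O_s(G), H] every H-invariant abelian
   subgroup is centralized by H (it would otherwise be the kernel of a Frobenius
   group with complement H, giving H a nonzero fixed vector), so D is
   extraspecial, |D / Z(D)| = s^(2a), with C_D(H) = Z(D).  Coset representatives
   of Z(D) in D are linearly independent matrices, so s^a <= n, while R acts
   semiregularly on D / Z(D), so |R| divides (s^a - 1)(s^a + 1).  As |R| >= r >= n + 1,
   this leaves only |R| = r = n + 1 = s^a + 1 with s = 2.  So it suffices that some
   Zsigmondy prime exists and that, when m is a power of 2, one of them has an
   r-part in q^m + 1 exceeding 2m + 1; this fails only if q^m + 1 = 2 (2m + 1),
   that is, if q = 3 and m = 2. *)

Require Import Defs.
From HB Require Import structures.
From mathcomp Require Import all_boot all_order all_algebra all_fingroup all_solvable.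
From mathcomp Require Import sesquilinear.
From mathcomp Require Import algC cyclotomic mxrepresentation mxabelem.
From mathcomp Require Import zify ring.

Set Implicit Arguments.
Unset Strict Implicit.
Unset Printing Implicit Defensive.

Import Order.TTheory GRing.Theory Num.Theory.

(** * Zsigmondy primes *)

Lemma dvdn_subX1 r q n : 0 < q -> (r %| q ^ n - 1) = (q ^ n == 1 %[mod r]).
Proof. by move=> q_gt0; rewrite eqn_mod_dvd // expn_gt0 q_gt0. Qed.

Lemma dvdn_subX1_mull r q a b : 0 < q -> r %| q ^ a - 1 -> r %| q ^ (b * a) - 1.
Proof.
move=> q_gt0; rewrite !dvdn_subX1 // => /eqP qa.
by rewrite mulnC expnM -modnXm qa modnXm exp1n.
Qed.

Lemma dvdn_subX1_gcd r q a b :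
  0 < q -> r %| q ^ a - 1 -> r %| q ^ b - 1 -> r %| q ^ gcdn a b - 1.
Proof.
move=> q_gt0; have [-> | a_gt0] := posnP a; first by rewrite gcd0n.
move=> ra rb; case: (egcdnP b a_gt0) => u v Duv _.
have:= dvdn_subX1_mull u q_gt0 ra; have:= dvdn_subX1_mull v q_gt0 rb.
rewrite Duv !dvdn_subX1 // expnD => /eqP rv.
by rewrite -modnMml rv modnMml mul1n.
Qed.

Lemma dvdn_subX1_Fermat q n r : 0 < q -> 0 < n -> prime r ->
  r %| q ^ n - 1 -> r %| q ^ r.-1 - 1.
Proof.
move=> q_gt0 n_gt0 r_pr rn.
have co_rq : coprime q r.
  rewrite coprime_sym prime_coprime //; apply/negP => rq.
  have : r %| q ^ n by rewrite dvdn_exp.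
  rewrite -(subnK (_ : 1 <= q ^ n)) ?expn_gt0 ?q_gt0 // dvdn_addr // dvdn1.
  by move/eqP=> r1; rewrite r1 in r_pr.
by rewrite dvdn_subX1 // -totient_prime //; apply/eqP/Euler_exp_totient.
Qed.

(** By Fermat [r] divides [q ^ gcd (n, r - 1) - 1], and minimality of [n] makes this gcd equal to
    [n]. *)
Lemma zsigmondy_dvd_pred q n r :
  0 < q -> 0 < n -> zsigmondy_prime q n r -> n %| r.-1.
Proof.
move=> q_gt0 n_gt0 [r_pr rn r_min].
have := dvdn_subX1_gcd q_gt0 rn (dvdn_subX1_Fermat q_gt0 n_gt0 r_pr rn).
set d := gcdn _ _; have [dn|nd] := ltnP d n.
  by rewrite (negbTE (r_min d _)) // dn gcdn_gt0 n_gt0.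
move=> _; have -> : n = d by apply/eqP; rewrite eqn_leq nd dvdn_leq ?dvdn_gcdl.
exact: dvdn_gcdr.
Qed.

Lemma sum_expn_mod r y t : y = 1 %[mod r] -> \sum_(i < t) y ^ i = t %[mod r].
Proof.
move=> y1; rewrite -modn_summ (eq_bigr (fun _ => 1 %% r)) => [|i _].
  by rewrite modn_summ sum1_card card_ord.
by rewrite -modnXm y1 modnXm exp1n.
Qed.

(* With [y = 1 + r u], the sum is [r + r u * r (r - 1) / 2] modulo [r ^ 2]. *)
Lemma sum_expn_mod_sqr r y : odd r -> 0 < y -> y = 1 %[mod r] ->
  \sum_(i < r) y ^ i = r %[mod r ^ 2].
Proof.
move=> r_odd y_gt0 /eqP; rewrite eqn_mod_dvd // => /dvdnP[u Dy].
have {}Dy : y = 1 + u * r by rewrite -Dy subnKC.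
have yX i : y ^ i = 1 + i * u * r %[mod r ^ 2].
  elim: i => [|i IHi]; first by rewrite !mul0n.
  rewrite expnS -modnMmr IHi modnMmr Dy.
  rewrite (_ : _ * _ = (u * i * u) * r ^ 2 + (1 + i.+1 * u * r));
    last by rewrite -mulnn; ring.
  by rewrite modnMDl.
rewrite -modn_summ (eq_bigr (fun i : 'I_r => (1 + i * u * r) %% r ^ 2)) => [|i _].
  rewrite modn_summ big_split /= sum1_card card_ord -!big_distrl /=.
  rewrite -(big_mkord xpredT (fun i => i)) bin2_sum.
  case: r r_odd {Dy yX} => // r r_even; rewrite /= bin2odd //=.
  rewrite (_ : r.+1 + _ = (r./2 * u) * r.+1 ^ 2 + r.+1); last by rewrite -mulnn; ring.
  by rewrite modnMDl.
exact: yX.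
Qed.

(** * Values of cyclotomic polynomials *)

Lemma prod_divisors_dvd (R : comNzSemiRingType) (f : nat -> R) n t :
  0 < n -> 1 < t -> t %| n -> exists g : R,
  (\prod_(d <- divisors n) f d = f n * \prod_(d <- divisors (n %/ t)%N) f d * g)%R.
Proof.
move=> n_gt0 t_gt1 t_n; have k_n := dvdn_div t_n; set k := n %/ t in k_n *.
have k_gt0 : 0 < k := dvdn_gt0 n_gt0 k_n.
have ltkn : k < n by rewrite ltn_Pdiv.
exists (\prod_(d <- rem n (divisors n) | ~~ (d %| k)%N) f d)%R.
rewrite (big_rem n) /=; last by rewrite -dvdn_divisors.
rewrite -mulrA; congr (_ * _)%R.
rewrite (bigID (dvdn^~ k)) /= -big_filter; congr (_ * _)%R.
apply: perm_big; apply: uniq_perm.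
- by rewrite filter_uniq ?rem_uniq ?divisors_uniq.
- exact: divisors_uniq.
move=> d; rewrite mem_filter mem_rem_uniq ?divisors_uniq // inE -!dvdn_divisors //.
case d_k: (d %| k) => //=; rewrite (dvdn_trans d_k) // andbT.
by apply: contraTneq d_k => ->; rewrite gtnNdvd.
Qed.

Definition cyclotomic_value n q := `|('Phi_n).[q%:Z]%R|%N.

(** As [n] does not divide [n %/ t], the factor [Phi_n] of [X ^ n - 1] is not among those of
    [X ^ (n / t) - 1]. *)
Lemma cyclotomic_value_dvd n q t : 0 < q -> 0 < n -> 1 < t -> t %| n ->
  cyclotomic_value n q * (q ^ (n %/ t) - 1) %| q ^ n - 1.
Proof.
move=> q_gt0 n_gt0 t_gt1 t_n.
have [g] := prod_divisors_dvd Cyclotomic n_gt0 t_gt1 t_n.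
have k_gt0 : 0 < n %/ t := dvdn_gt0 n_gt0 (dvdn_div t_n).
rewrite !prod_Cyclotomic // => /(congr1 (fun p => `|p.[q%:Z]%R|%N)).
have val_Xn j : `|('X^j - 1 : {poly int}).[q%:Z]%R|%N = q ^ j - 1.
  rewrite hornerD hornerN hornerC hornerXn.
  rewrite (_ : (q%:Z ^+ j - 1 = (q ^ j - 1)%N%:Z)%R) //.
  by rewrite -subzn ?expn_gt0 ?q_gt0 // -!natz natrX.
by rewrite !hornerM !abszM !val_Xn => ->; rewrite dvdn_mulr.
Qed.

(** [Phi_n(q)] is a product of [totient n] factors [q - z ^ i], each of modulus at least
    [q - 1 >= 2] because [z] has modulus 1. *)
Lemma leq_cyclotomic_value n q : 2 < q -> 0 < n -> 2 ^ totient n <= cyclotomic_value n q.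
Proof.
move=> q_gt2 n_gt0; have [z prim_z] := C_prim_root_exists n_gt0.
rewrite -(ler_nat algC) natrX /cyclotomic_value.
rewrite natr_absz intr_norm.
have -> : ((('Phi_n).[q%:Z])%:~R = (cyclotomic z n).[q%:R] :> algC)%R.
  by rewrite -Cintr_Cyclotomic // -(horner_map intr) /= pmulrn.
rewrite horner_prod normr_prod totient_count_coprime big_mkord.
rewrite expr_sum [leRHS]big_mkcond /=.
apply: ler_prod => i _; rewrite coprime_sym; case: (coprime _ _) => /=;
  last by rewrite expr0 ler01 lexx.
rewrite expr1 hornerXsubC ler0n /=.
apply: le_trans (lerB_dist _ _); rewrite normr_nat normrX.
have -> : (`|z| = 1)%R.
    apply/eqP; rewrite -(pexpr_eq1 n_gt0) // -normrX (prim_expr_order prim_z).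
    by rewrite normr1.
  rewrite expr1n.
by rewrite lerBrDr -(natrD _ 2 1) ler_nat.
Qed.

(** The geometric sum is the quotient of [q ^ n - 1] by [q ^ (n / t) - 1]. *)
Lemma cyclotomic_value_dvd_sum n q t : 1 < q -> 0 < n -> 1 < t -> t %| n ->
  cyclotomic_value n q %| \sum_(i < t) (q ^ (n %/ t)) ^ i.
Proof.
move=> q_gt1 n_gt0 t_gt1 t_n.
have := cyclotomic_value_dvd (ltnW q_gt1) n_gt0 t_gt1 t_n.
rewrite -[in q ^ n](divnK t_n) expnM !subn1 (predn_exp (q ^ _)) mulnC.
rewrite dvdn_pmul2l // -subn1 subn_gt0 -(exp1n (n %/ t)) ltn_exp2r //.
exact: dvdn_gt0 n_gt0 (dvdn_div t_n).
Qed.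

Lemma zsigmondyP q n r : reflect (zsigmondy_prime q n r)
  [&& prime r, r %| q ^ n - 1 & [forall j : 'I_n, (0 < j) ==> ~~ (r %| q ^ j - 1)]].
Proof.
apply: (iffP and3P) => -[r_pr rn r_min]; split=> //.
  move=> j /andP[j_gt0 j_lt].
  by have /forallP/(_ (Ordinal j_lt))/implyP := r_min; apply.
by apply/forallP=> j; apply/implyP=> j_gt0; apply: r_min; rewrite j_gt0 /=.
Qed.

(* If [r] is not a Zsigmondy prime, then [n / t] is a multiple of the order of
   [q] modulo [r] for some prime [t]; the geometric sum then forces [t = r]. *)
Lemma cyclotomic_value_nonzsigmondy n q r : 1 < q -> 1 < n -> prime r ->
    r %| cyclotomic_value n q -> ~ zsigmondy_prime q n r ->
  [/\ r %| n, q ^ (n %/ r) = 1 %[mod r] &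
      forall t, prime t -> t %| n -> t != r -> t %| r.-1].
Proof.
move=> q_gt1 n_gt1 r_pr r_val nzs.
have [q_gt0 n_gt0] := (ltnW q_gt1, ltnW n_gt1).
have rn : r %| q ^ n - 1.
  apply: dvdn_trans r_val (dvdn_trans (dvdn_mulr _ (dvdnn _)) _).
  exact: cyclotomic_value_dvd q_gt0 n_gt0 (prime_gt1 (pdiv_prime n_gt1)) (pdiv_dvd n).
have uniq_t t : prime t -> t %| n -> r %| q ^ (n %/ t) - 1 -> t = r.
  move=> t_pr t_n; rewrite dvdn_subX1 // => /eqP qt.
  have := dvdn_trans r_val (cyclotomic_value_dvd_sum q_gt1 n_gt0 (prime_gt1 t_pr) t_n).
  by rewrite /dvdn (sum_expn_mod t qt) -/(dvdn _ _) dvdn_prime2 // => /eqP.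
have up d t : t %| n -> d %| n %/ t -> r %| q ^ d - 1 -> r %| q ^ (n %/ t) - 1.
  by move=> _ /dvdnP[c ->]; apply: dvdn_subX1_mull.
have /existsP[j /andP[j_gt0 rj]] : [exists j : 'I_n, (0 < j) && (r %| q ^ j - 1)].
  apply: contraT; rewrite negb_exists => no_j; case: nzs; apply/zsigmondyP.
  rewrite r_pr rn; apply/forallP=> j; apply/implyP=> j_gt0.
  by have := forallP no_j j; rewrite j_gt0.
have d_n := dvdn_gcdr j n; have rd := dvdn_subX1_gcd q_gt0 rj rn.
set d := gcdn j n in d_n rd.
have nd_gt1 : 1 < n %/ d.
  rewrite ltn_divRL // mul1n (leq_ltn_trans _ (ltn_ord j)) //.
  by rewrite dvdn_leq ?dvdn_gcdl.
pose t := pdiv (n %/ d); have t_pr : prime t by rewrite pdiv_prime.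
have /dvdnP[c Dc] : t %| n %/ d by exact: pdiv_dvd.
have Dn : n = c * d * t by rewrite -(divnK d_n) Dc mulnAC.
have t_n : t %| n by rewrite Dn dvdn_mull.
have rt : r %| q ^ (n %/ t) - 1.
  by apply: (up d) => //; rewrite {1}Dn mulnK ?prime_gt0 // dvdn_mull.
have Dt := uniq_t t t_pr t_n rt; rewrite Dt in t_n rt.
split=> //; first by apply/eqP; rewrite -dvdn_subX1.
move=> u u_pr u_n; apply: contraNT => u_r; apply/eqP/(uniq_t u u_pr u_n).
(* If [u] does not divide [r - 1], then [gcdn n r.-1] divides [n / u], and [uniq_t] yields
   [u = r]. *)
have rf := dvdn_subX1_gcd q_gt0 rn (dvdn_subX1_Fermat q_gt0 n_gt0 r_pr rn).
have co_u : coprime (gcdn n r.-1) u.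
  by rewrite coprime_sym prime_coprime // dvdn_gcd negb_and u_r orbT.
by apply: (up _ _ u_n _ rf); rewrite -(Gauss_dvdr _ co_u) mulnC divnK ?dvdn_gcdl.
Qed.

(* A prime divisor of [Phi_n(q)] which is not a Zsigmondy prime is unique and
   divides [Phi_n(q)] only once, so it would have to exceed [2 ^ (r - 1)]. *)
Lemma zsigmondy_exists q n : 2 < q -> 1 < n -> ~~ 2.-nat n ->
  exists r, zsigmondy_prime q n r.
Proof.
move=> q_gt2 n_gt1 n_not2; have [q_gt1 n_gt0] := (ltnW q_gt2, ltnW n_gt1).
set N := cyclotomic_value n q.
have leN : 2 ^ totient n <= N by exact: leq_cyclotomic_value.
have N_gt1 : 1 < N.
  by apply: leq_trans leN; rewrite -{1}(expn0 2) ltn_exp2l // totient_gt0.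
have [/hasP[r _ /zsigmondyP] | /hasPn noz] :=
  boolP (has (fun r => [&& prime r, r %| q ^ n - 1 &
    [forall j : 'I_n, (0 < j) ==> ~~ (r %| q ^ j - 1)]]) (primes N)).
  by exists r.
have nonz u : prime u -> u %| N ->
  [/\ u %| n, q ^ (n %/ u) = 1 %[mod u] &
      forall t, prime t -> t %| n -> t != u -> t %| u.-1].
  move=> u_pr u_N; apply: cyclotomic_value_nonzsigmondy => // /zsigmondyP.
  by apply/negP/noz; rewrite mem_primes u_pr u_N ltnW.
pose r := pdiv N; have r_pr : prime r := pdiv_prime N_gt1.
have r_gt1 := prime_gt1 r_pr.
have [r_n qr r_max] := nonz r r_pr (pdiv_dvd N).
(* Two distinct primes dividing [N] would each divide the predecessor of the other. *)
have N_r : N = r ^ logn r N.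
  rewrite -p_part part_pnat_id //; apply/pnatP=> [|u u_pr u_N]; first exact: ltnW.
  rewrite inE; apply: contraT => neq_ur; have [u_n _ u_max] := nonz u u_pr u_N.
  have lt_pred s t : prime s -> t %| s.-1 -> t < s.
    by move=> /prime_gt1; case: s => [|[|s]] //= _ /(dvdn_leq (ltn0Sn _)).
  have lt_ur := lt_pred _ _ r_pr (r_max u u_pr u_n neq_ur).
  rewrite eq_sym in neq_ur; have lt_ru := lt_pred _ _ u_pr (u_max r r_pr r_n neq_ur).
  by have := ltn_trans lt_ur lt_ru; rewrite ltnn.
have r_odd : odd r.
  apply: contraR n_not2 => /(prime_oddPn r_pr) r2.
  apply/pnatP=> // t t_pr t_n; rewrite inE -r2.
  apply: contraT => /(r_max t t_pr t_n); rewrite r2 dvdn1 => /eqP t1.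
  by rewrite t1 in t_pr.
(* The geometric sum is [r] modulo [r ^ 2], so [r ^ 2] does not divide [N]. *)
have N_le_r : N <= r.
  rewrite N_r -[leqRHS]expn1 leq_exp2l // leqNgt; apply/negP => r2N.
  have : r ^ 2 %| \sum_(i < r) (q ^ (n %/ r)) ^ i.
    apply: dvdn_trans (cyclotomic_value_dvd_sum q_gt1 n_gt0 r_gt1 r_n).
    by rewrite -/N N_r dvdn_exp2l.
  rewrite /dvdn sum_expn_mod_sqr ?expn_gt0 ?(ltnW q_gt1) // -/(dvdn _ _).
  by move/(dvdn_leq (ltnW r_gt1)); rewrite -[leqRHS]expn1 leq_exp2l.
have tot_r : r.-1 <= totient n.
  rewrite dvdn_leq ?totient_gt0 // -(partnC r n_gt0) totient_coprime.
    by rewrite p_part totient_pfactor ?logn_gt0 ?mem_primes ?r_pr ?n_gt0 //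
      -mulnA dvdn_mulr.
  exact: coprime_partC.
have := leq_trans (leq_pexp2l (isT : 0 < 2) tot_r) (leq_trans leN N_le_r).
have r_gt2 : 2 < r by rewrite odd_gt2.
rewrite -(subnK r_gt2) addn3 /= expnS.
by have := ltn_expl (r - 3).+1 (isT : 1 < 2); lia.
Qed.

(** * Linear representations *)

Section Representations.

Local Open Scope group_scope.
Local Open Scope ring_scope.

(** Nontrivial orbits of an [r]-group on the vectors of [U] have length divisible by [r]. *)
Lemma pgroup_mxmodule_fix_mod (F : finFieldType) (gT : finGroupType) (H : {group gT})
    n (rH : mx_representation F H n.+1) (r : nat) (U : 'M_n.+1) :
  r.-group H -> mxmodule rH U ->
  (#|F| ^ \rank U = #|F| ^ \rank (U :&: rfix_mx rH H)%MS %[mod r])%N.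
Proof.
move=> rH_gp modU; have := pgroup_fix_mod rH_gp (_ : [acts H, on rowg U | 'MR rH]).
by rewrite acts_rowg afix_repr // -rowgI !card_rowg; apply.
Qed.

(** By minimality, a proper subspace whose cardinality is 1 modulo [r] is zero. This applies first
    to the fixed space, then to any proper submodule. *)
Lemma zsigmondy_mx_irr (F : finFieldType) (gT : finGroupType) (H : {group gT})
    n (rH : mx_representation F H n.+1) (r : nat) :
  zsigmondy_prime #|F| n.+1 r -> r.-group H -> ~~ (H \subset rker rH) ->
  mx_irreducible rH.
Proof.
move=> [r_pr rn r_min] rH_gp ntH.
have F_gt0 : (0 < #|F|)%N by apply/card_gt0P; exists 0.
have rank0 k : (k < n.+1)%N -> #|F| ^ k = 1 %[mod r] -> k = 0%N.
  case: k => // k lt_k /eqP; rewrite -dvdn_subX1 // => r_k.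
  by have := r_min k.+1; rewrite lt_k r_k => /(_ isT).
have fix0 : rfix_mx rH H = 0.
  apply/eqP; rewrite -mxrank_eq0; apply/eqP/rank0.
    rewrite ltn_neqAle rank_leq_row andbT; apply: contra ntH => full.
    by rewrite /rker rfix_mx_rstabC // sub1mx.
  have := pgroup_mxmodule_fix_mod rH_gp (mxmodule1 rH).
  rewrite mxrank1 (capmx_idPr (submx1 _)) => <-.
  by apply/eqP; rewrite -dvdn_subX1.
apply/mx_irrP; split=> // U modU nzU.
rewrite /row_full eqn_leq rank_leq_row leqNgt /=; apply: contra nzU => lt_U.
rewrite -mxrank_eq0; apply/eqP/rank0 => //.
by rewrite (pgroup_mxmodule_fix_mod rH_gp modU) fix0 capmx0 mxrank0.
Qed.

(** On a nonzero vector [u], [f] agrees with some [A] in the enveloping algebra; [f - A] commutes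
    with [H] and kills [u], so [f = A] by Schur. Every such [A] commutes with [g]. *)
Lemma abelian_irr_cent_comm (F : fieldType) (gT : finGroupType) (H : {group gT})
    n (rH : mx_representation F H n) (f g : 'M_n) :
  mx_irreducible rH -> abelian H -> centgmx rH f -> centgmx rH g ->
  f *m g = g *m f.
Proof.
move=> irrH cHH cf cg.
suffices /envelop_mxP[a ->] : (f \in enveloping_algebra_mx rH)%MS.
  rewrite mulmx_suml mulmx_sumr; apply: eq_bigr => x Hx.
  by rewrite -scalemxAl -scalemxAr (centgmxP cg).
have [n_gt0 _] := (mx_irrP rH).1 irrH.
pose u : 'rV[F]_n := delta_mx 0 (Ordinal n_gt0).
have nz_u : u != 0.
  by apply/negP=> /eqP/matrixP/(_ 0 (Ordinal n_gt0))/eqP; rewrite !mxE !eqxx oner_eq0.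
have /cyclic_mxP[A EA Duf] : (u *m f <= cyclic_mx rH u)%MS.
  by rewrite -(mxsimple_cyclic irrH nz_u (submx1 u)) submx1.
suffices -> : f = A by [].
apply/eqP; rewrite -subr_eq0; apply: contraT => nz_fA.
have /(mx_Schur irrH)/(_ nz_fA) unit_fA : centgmx rH (f - A).
  apply/centgmxP=> x Hx; rewrite mulmxBl mulmxBr (centgmxP cf) //; congr (_ - _).
  have /envelop_mxP[a ->] := EA; rewrite mulmx_suml mulmx_sumr; apply: eq_bigr => y Hy.
  by rewrite -scalemxAl -scalemxAr -!repr_mxM // (centsP cHH).
case/negP: nz_u; rewrite -(mulmxK unit_fA u) mulmxBr Duf subrr mul0mx //.
Qed.

Lemma faithful_irr_cent_abelian (F : fieldType) (gT : finGroupType) (G H : {group gT})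
    (sHG : H \subset G) n (rG : mx_representation F G n) :
  mx_faithful rG -> mx_irreducible (subg_repr rG sHG) -> abelian H ->
  abelian 'C_G(H).
Proof.
move=> injG irrH cHH.
have cent x : x \in 'C_G(H) -> centgmx (subg_repr rG sHG) (rG x).
  case/setIP=> Gx /centP cx; apply/centgmxP=> y Hy /=.
  by have Gy := subsetP sHG y Hy; rewrite -!repr_mxM // cx.
apply/centsP=> x Cx y Cy; have [[Gx _] [Gy _]] := (setIP Cx, setIP Cy).
apply: (mx_faithful_inj injG); rewrite ?groupM // !repr_mxM //.
exact: abelian_irr_cent_comm irrH cHH (cent x Cx) (cent y Cy).
Qed.

Lemma sum_repr_rfix0 (F : fieldType) (gT : finGroupType) (G L : {group gT})
    n (rG : mx_representation F G n) :
  L \subset G -> rfix_mx rG L = 0 -> \sum_(x in L) rG x = 0.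
Proof.
move=> sLG fix0; set S := (X in X = 0); suffices : (S <= rfix_mx rG L)%MS.
  by rewrite fix0 => /submx0null.
apply/rfix_mxP=> y Ly; rewrite {}/S mulmx_suml [RHS](reindex_inj (mulIg y)) /=;
  apply: eq_big => x.
  by rewrite /= groupMr.
by move=> Lx; rewrite repr_mxM ?(subsetP sLG).
Qed.

(** [G] is partitioned into [K] and [#|K|] conjugates of [H^#]. The sums of [rG] over [G] and over
    each conjugate of [H] vanish, so the sum over [K] is the scalar [#|K|]; multiplying it by [rG z]
    with [z] in [K] only permutes its terms. *)
Lemma Frobenius_rfix0_rker (F : fieldType) (gT : finGroupType) (G K H : {group gT})
    n (rG : mx_representation F G n) :
  [Frobenius G = K ><| H] -> #|K|%:R != 0 :> F -> rfix_mx rG H = 0 ->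
  K \subset rker rG.
Proof.
move=> frobG nzK fixH; have [defG _ ntH _ _] := Frobenius_context frobG.
have [sKG sHG] := mulG_sub (sdprodW defG).
have K_notin : gval K \notin H^# :^: K.
  apply/imsetP=> -[y _ defK]; have := group1 K.
  by rewrite defK mem_conjg conj1g !inE eqxx.
pose c := #|H^# :^: K|.
have cardG : (#|G| = #|K| + c * #|H|.-1)%N.
  rewrite (card_partition (Frobenius_partition frobG)) big_setU1 //=; congr (_ + _)%N.
  rewrite -sum_nat_const; apply: eq_bigr => _ /imsetP[y _ ->].
  by rewrite cardJg [in RHS](cardsD1 1%g) group1.
have cK : c = #|K|.
  have H_gt0 : (0 < #|H|.-1)%N by rewrite ltn_predRL cardG_gt1.
  apply/eqP; rewrite -(eqn_pmul2r H_gt0) -(eqn_add2l #|K|) -cardG -(sdprod_card defG).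
  by rewrite -mulnS prednK.
have sumA A : A \in H^# :^: K -> \sum_(x in A) rG x = - 1%:M.
  case/imsetP=> y Ky ->{A}; have Gy := subsetP sKG y Ky.
  have sHyG : H :^ y \subset G by rewrite conj_subG.
  apply/eqP; rewrite -addr_eq0 addrC; apply/eqP.
  rewrite conjD1g -(repr_mx1 rG) -big_setD1 ?group1 //.
  apply: sum_repr_rfix0 => //; apply/eqP; rewrite -mxrank_eq0.
  by rewrite (rfix_mx_conjsg _ Gy sHG) fixH mul0mx mxrank0.
have sumG : \sum_(x in G) rG x = 0.
  by apply: sum_repr_rfix0 => //; apply/eqP;
    rewrite -submx0 -[X in (_ <= X)%MS]fixH rfix_mxS.
have sumK : \sum_(x in K) rG x = #|K|%:R *: 1%:M.
  move: sumG; rewrite (set_partition_big _ (Frobenius_partition frobG)) big_setU1 //=.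
  rewrite (eq_bigr _ sumA) sumr_const -/c cK => /eqP.
  by rewrite mulNrn subr_eq0 => /eqP ->; rewrite scaler_nat.
apply/subsetP=> z Kz; rewrite inE (subsetP sKG) // mul1mx.
apply/eqP/(scalerI nzK); rewrite -sumK [RHS](reindex_inj (mulIg z)) /=.
rewrite (eq_bigl (mem K)) => [|x]; last by rewrite /= groupMr.
rewrite (eq_bigr (fun x => rG x *m rG z)) => [|x Kx].
  by rewrite -mulmx_suml sumK -scalemxAl mul1mx.
by rewrite repr_mxM ?(subsetP sKG).
Qed.

(* Otherwise [[K, H]] and [H] form a Frobenius group. *)
Lemma prime_rfix0_cent_abelian (F : fieldType) (gT : finGroupType) (G K H : {group gT})
    n (rG : mx_representation F G n) :
  mx_faithful rG -> K \subset G -> H \subset G -> rfix_mx rG H = 0 ->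
  prime #|H| -> H \subset 'N(K) -> coprime #|K| #|H| -> abelian K ->
  #|K|%:R != 0 :> F -> H \subset 'C(K).
Proof.
move=> injG sKG sHG fixH prH nKH coKH cKK nzK.
have [/commG1P | ntKH] := eqVneq [~: K, H] 1%g; first by rewrite centsC.
have sLK : [~: K, H] \subset K by rewrite commg_subl.
have nLH : H \subset 'N([~: K, H]) := commg_normr H K.
have ntH : H :!=: 1%g by rewrite -cardG_gt1 prime_gt1.
have coLH : coprime #|[~: K, H]| #|H| := coprimeSg sLK coKH.
have defL : [~: K, H] ><| H = [~: K, H] <*> H.
  by rewrite sdprodEY // coprime_TIg.
have frobL := introT (prime_FrobeniusP _ ntKH prH)
  (conj defL (coprime_abel_cent_TI nKH coKH cKK)).
have sLG : [~: K, H] <*> H \subset G by rewrite join_subG (subset_trans sLK).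
have nzL : #|[~: K, H]|%:R != 0 :> F.
  by apply: contraNneq nzK => L0; rewrite -(Lagrange sLK) natrM L0 mul0r.
case/eqP: ntKH; apply/trivgP/subset_trans/injG.
apply: subset_trans (Frobenius_rfix0_rker (rG := subg_repr rG sLG) frobL nzL _) _.
  exact: fixH.
by rewrite rker_subg subsetIr.
Qed.

(** Nilpotent normal subgroups of [N] lie in ['F(G)], which [N] centralizes, hence in ['Z(N)]. If
    [N] were not abelian, a nontrivial abelian normal subgroup of [N / 'Z(N)] would lift to a
    nilpotent one outside ['Z(N)]. *)
Lemma cent_sub_Fitting (gT : finGroupType) (G : {group gT}) :
  solvable G -> 'C_G('F(G)) \subset 'F(G).
Proof.
move=> solG; set N := 'C_G('F(G)).
have nsNG : N <| G by rewrite norm_normalI ?norms_cent ?gFnorm //.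
have nil_sub (A : {group gT}) : A <| N -> nilpotent A -> A \subset 'Z(N).
  move=> nsAN nilA; have sAF : A \subset 'F(G).
    apply: subset_trans (_ : A \subset 'F(N)) _; first exact: Fitting_max.
    by rewrite Fitting_max ?Fitting_nil // gFnormal_trans.
  by rewrite subsetI normal_sub //= centsC subIset // centS ?orbT.
have solN : solvable N := solvableS (subsetIl _ _) solG.
have nZN : N \subset 'N('Z(N)) by exact: gFnorm.
suffices sNZ : N \subset 'Z(N).
  apply: Fitting_max => //; apply: abelian_nil.
  by rewrite (abelianS sNZ) ?center_abelian.
rewrite -quotient_sub1 // subG1; apply: contraT => ntNZ.
have [A0 [_ nsA0 ntA0 /is_abelemP[p _ /abelem_abelian cA0]]] :=
  solvable_norm_abelem (quotient_sol _ solN) (normal_refl (N / 'Z(N))) ntNZ.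
have [A defA sZA nsAN] := inv_quotientN (center_normal _) nsA0.
have nZA := subset_trans (normal_sub nsAN) nZN.
case/negP: ntA0; rewrite defA -subG1 quotient_sub1 //; apply: nil_sub => //.
rewrite -quotient_center_nil abelian_nil // sub_der1_abelian // subsetI der_sub.
have: (A^`(1) \subset 'Z(N))%g by rewrite der1_min // -defA.
move/subset_trans; apply; rewrite (subset_trans (subsetIr _ _)) //.
by rewrite centS // normal_sub.
Qed.

(** By coprime action [K] is the product of ['C_K(A)] and [[~: K, A]], and the first factor
    contributes nothing to commutators with [A]. *)
Lemma coprime_commGid (gT : finGroupType) (K A : {group gT}) :
  A \subset 'N(K) -> coprime #|K| #|A| -> solvable K ->
  [~: K, A, A] = [~: K, A].
Proof.
move=> nKA coKA solK; apply/eqP; rewrite eqEsubset commSg ?commg_subl //=.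
rewrite gen_subG; apply/subsetP=> _ /imset2P[x a Kx Aa ->].
have sLK : [~: K, A] \subset K by rewrite commg_subl.
have nLK : K \subset 'N([~: K, A]) by rewrite commg_norml.
have : x \in ([~: K, A] * 'C_K(A))%g.
  apply: subsetP x Kx; rewrite -quotientSK // coprime_norm_quotient_cent //.
  - by rewrite subsetI subxx quotient_cents2r.
  - exact: commg_normr.
  - exact: coprimeSg sLK coKA.
  exact: solvableS sLK solK.
rewrite -normC ?(subset_trans (subsetIl _ _)) // =>
  /mulsgP[y z /setIP[_ /centP cy] Lz ->].
have /commgP/eqP cya : commute y a := cy a Aa.
by rewrite commMgJ cya conj1g mul1g mem_commg.
Qed.

Lemma mx_irr_rfix0 (F : fieldType) (gT : finGroupType) (H : {group gT}) n
    (rH : mx_representation F H n) :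
  mx_irreducible rH -> ~~ (H \subset rker rH) -> rfix_mx rH H = 0.
Proof.
move=> /mx_irrP[_ irrH] ntH; apply/eqP; apply: contraR ntH.
by move/(irrH _ (rfix_mx_module rH)); rewrite /rker rfix_mx_rstabC // -sub1mx.
Qed.

(* Coset representatives of ['Z(D)] in [D] are even linearly independent over
   the field of matrices commuting with [D] and [H]: conjugating a shortest
   relation by an element of [D] and subtracting would give a shorter one. *)
Lemma center_transversal_free (F : fieldType) (gT : finGroupType) (G D H : {group gT})
    (sHG : H \subset G) n (rG : mx_representation F G n) (T : {set gT})
    (c : gT -> 'M[F]_n) :
    mx_faithful rG -> mx_irreducible (subg_repr rG sHG) -> D \subset G ->
    (D^`(1) \subset 'Z(D))%g -> 'Z(D) \subset 'C(H) ->
    T \subset D -> {in T &, forall x y, (x * y^-1)%g \in 'Z(D) -> x = y} ->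
    (forall x g, x \in T -> g \in D :|: H -> c x *m rG g = rG g *m c x) ->
    \sum_(x in T) c x *m rG x = 0 ->
  {in T, forall x, c x = 0}.
Proof.
move=> injG irrH sDG sD'Z cZH sTD injT cc sum0.
have sZD : 'Z(D) \subset D := center_sub D.
have central z g : z \in 'Z(D) -> g \in D :|: H -> commute z g.
  move=> Zz /setUP[Dg | Hg]; last exact: (centsP cZH).
  by have /setIP[_ /centP] := Zz; apply.
have sDHG : D :|: H \subset G by rewrite subUset sDG.
have rZ z g : z \in 'Z(D) -> g \in D :|: H -> rG z *m rG g = rG g *m rG z.
  move=> Zz DHg; have Gz := subsetP (subset_trans sZD sDG) z Zz.
  by have Gg := subsetP sDHG g DHg; rewrite -!repr_mxM // (central z g).
have [k] := ubnP #|[set x in T | c x != 0]|.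
elim: k c cc sum0 => // k IHk c cc sum0 le_k x1 Tx1; apply/eqP; apply: contraT => nz1.
have [x0 /and3P[Tx0 nz0 neq01] | only1] :=
  pickP [pred x | [&& x \in T, c x != 0 & x != x1]]; last first.
  move: sum0; rewrite (bigD1 x1) //= big1 ?addr0 => [|x /andP[Tx nx1]].
    move/(canRL (mulmxK (repr_mx_unit rG (subsetP sDG _ (subsetP sTD _ Tx1))))).
    by rewrite mul0mx => c0; rewrite c0 eqxx in nz1.
  have := only1 x; rewrite /= Tx nx1 andbT => /negbFE/eqP->.
  by rewrite mul0mx.
have [Dx0 Dx1] := (subsetP sTD _ Tx0, subsetP sTD _ Tx1).
have Zcomm x g : x \in D -> g \in D -> [~ x, g]%g \in 'Z(D).
  by move=> Dx Dg; rewrite (subsetP sD'Z) // mem_commg.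
(* Otherwise [x0 * x1^-1] would centralize [D], against [injT]. *)
have [g Dg neq_g] : exists2 g, g \in D & [~ x0, g]%g != [~ x1, g]%g.
  apply/exists_inP; apply: contraT; rewrite negb_exists_in => /forall_inP eq_g.
  case/eqP: neq01; apply: injT => //; apply/centerP; split;
    first by rewrite groupM ?groupV.
  move=> g Dg; have /negPn/eqP eqg := eq_g g Dg.
  apply/commgP/conjg_fixP; rewrite conjMg conjVg (conjg_mulR x0) (conjg_mulR x1) eqg.
  by rewrite invMg mulgA mulgK.
pose z x := [~ x, g]%g.
(* These are the coefficients of the relation conjugated by [g] minus [rG (z x0)] times the original
   one; the term at [x0] disappears. *)
pose c' x := c x *m (rG (z x) - rG (z x0)).
have Zz x : x \in T -> z x \in 'Z(D) by move=> Tx; exact: Zcomm (subsetP sTD x Tx) Dg.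
have DHg : g \in D :|: H by rewrite inE Dg.
have Gg := subsetP sDG g Dg.
have c'x1 : c' x1 = 0.
  apply: (IHk c') => // [x h Tx DHh||].
  - rewrite /c' -mulmxA mulmxBl (rZ _ _ (Zz x Tx) DHh) (rZ _ _ (Zz x0 Tx0) DHh).
    by rewrite -mulmxBr !mulmxA (cc x h).
  - transitivity (\sum_(x in T) (rG g^-1%g *m (c x *m rG x) *m rG g -
                                 rG (z x0) *m (c x *m rG x))).
      apply: eq_bigr => x Tx; have Dx := subsetP sTD x Tx; have Gx := subsetP sDG x Dx.
      have DHz y : y \in T -> z y \in D :|: H by move=> Ty; rewrite inE (subsetP sZD) ?Zz.
      have DHV : g^-1%g \in D :|: H by rewrite inE groupV Dg.
      have DHx : x \in D :|: H by rewrite inE Dx.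
      rewrite /c' mulmxBr mulmxBl; congr (_ - _).
        rewrite mulmxA -(cc x _ Tx DHV) -!mulmxA; congr (_ *m _).
        rewrite (rZ _ _ (Zz x Tx) DHx) -!repr_mxM ?groupM ?groupV ?groupR //.
        by rewrite -conjg_mulR conjgE mulgA.
      by rewrite (cc x _ Tx (DHz x0 Tx0)) mulmxA.
    by rewrite sumrB -mulmx_suml -!mulmx_sumr sum0 mulmx0 mul0mx mulmx0 subr0.
  rewrite -ltnS; apply: leq_trans le_k; rewrite ltnS; apply: proper_card.
  apply/properP; split.
    apply/subsetP=> x; rewrite !inE => /andP[->] /=; apply: contra => /eqP c0.
    by rewrite /c' c0 mul0mx.
  by exists x0; rewrite !inE Tx0 // /c' subrr mulmx0 eqxx.
(* A difference of two distinct central elements commutes with [H], so it is invertible by Schur. *)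
case/eqP: nz1; suffices unit_z : rG (z x1) - rG (z x0) \in unitmx.
  by rewrite -(mulmxK unit_z (c x1)) -/(c' x1) c'x1 mul0mx.
apply: (mx_Schur irrH).
  apply/centgmxP=> h Hh /=; have DHh : h \in D :|: H by rewrite inE Hh orbT.
  by rewrite mulmxBl mulmxBr (rZ _ _ (Zz x1 Tx1) DHh) (rZ _ _ (Zz x0 Tx0) DHh).
rewrite subr_eq0; apply: contra neq_g => /eqP /(mx_faithful_inj injG) eqz.
by rewrite eq_sym; apply/eqP/eqz; apply: (subsetP (subset_trans sZD sDG)); apply: Zz.
Qed.

Lemma index_center_leq (F : fieldType) (gT : finGroupType) (G D H : {group gT})
    (sHG : H \subset G) n (rG : mx_representation F G n) :
    mx_faithful rG -> mx_irreducible (subg_repr rG sHG) -> D \subset G ->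
    (D^`(1) \subset 'Z(D))%g -> 'Z(D) \subset 'C(H) ->
  (#|D : 'Z(D)| <= n ^ 2)%N.
Proof.
move=> injG irrH sDG sD'Z cZH.
pose T := [set repr A | A in rcosets 'Z(D) D].
have reprK A : A \in rcosets 'Z(D) D -> 'Z(D) :* repr A = A.
  by case/rcosetsP=> x Dx ->; rewrite rcoset_repr.
have <- : #|T| = #|D : 'Z(D)|.
  by rewrite card_in_imset // => A B /reprK {2}<- /reprK {2}<- ->.
have sTD : T \subset D.
  apply/subsetP=> _ /imsetP[_ /rcosetsP[x Dx ->] ->].
  have /rcosetP[z Zz ->] := mem_repr_rcoset 'Z(D) x.
  by rewrite groupM // (subsetP (center_sub D)).
have injT : {in T &, forall x y, (x * y^-1)%g \in 'Z(D) -> x = y}.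
  move=> _ _ /imsetP[A DA ->] /imsetP[B DB ->] Zab; congr repr.
  by rewrite -(reprK A) // -(reprK B) //; apply/rcoset_eqP; rewrite mem_rcoset.
rewrite -mulnn; set M := \matrix_(i < #|T|) mxvec (rG (enum_val i)).
suffices /eqP <- : row_free M by exact: rank_leq_col.
apply: inj_row_free => v; rewrite mulmx_sum_row => /(congr1 vec_mx).
rewrite linear0 linear_sum => sum0; apply/rowP=> i; rewrite mxE.
have Ti := enum_valP i.
pose c x := (v 0 (enum_rank_in Ti x))%:M : 'M[F]_n.
have : c (enum_val i) = 0.
  apply: (center_transversal_free injG irrH sDG sD'Z cZH sTD injT) (Ti).
    by move=> x g _ _; rewrite scalar_mxC.
  rewrite big_enum_val -[RHS]sum0; apply: eq_bigr => j _.
  by rewrite linearZ /= rowK mxvecK mul_scalar_mx /c enum_valK_in.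
rewrite /c enum_valK_in; have [n_gt0 _] := (mx_irrP _).1 irrH.
by move/matrixP/(_ (Ordinal n_gt0) (Ordinal n_gt0)); rewrite !mxE eqxx.
Qed.

(** * Sylow subgroups for a Zsigmondy prime *)

Lemma prime_cent_pcore_cent_Fitting (gT : finGroupType) (G H : {group gT}) :
  (forall s, prime s -> H \subset 'C('O_s(G))) -> H \subset 'C('F(G)).
Proof.
move=> cH; rewrite FittingEgen cent_gen; apply/centsP=> x Hx y /bigcupP[s s_pi Oy].
have s_pr : prime s by move: s_pi; rewrite mem_primes => /and3P[].
exact: (centsP (cH s s_pr)).
Qed.

(** An odd prime cannot divide both [N - 1] and [N + 1]. *)
Lemma pexp_dvd_pred_sqr r e N : prime r -> odd r -> (1 < N)%N ->
  (r ^ e %| (N ^ 2).-1)%N -> (r ^ e %| N.-1)%N || (r ^ e %| N.+1)%N.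
Proof.
move=> r_pr r_odd N_gt1.
rewrite (_ : (N ^ 2).-1 = N.-1 * N.+1)%N; last by rewrite -mulnn;
  case: N N_gt1 => //= N _; lia.
have [r_dv | r_ndv] := boolP (r %| N.+1)%N.
  have r_ndv : ~~ (r %| N.-1)%N.
    apply/negP=> r_dv1; have := dvdn_sub r_dv r_dv1.
    rewrite (_ : N.+1 - N.-1 = 2)%N; last by lia.
    by rewrite dvdn_prime2 // => /eqP r2; rewrite r2 in r_odd.
  by rewrite Gauss_dvdr ?coprimeXl ?prime_coprime // => ->; rewrite orbT.
by rewrite Gauss_dvdl ?coprimeXl ?prime_coprime // => ->.
Qed.

Theorem non_normal_Sylow_card (F : finFieldType) (gT : finGroupType)
    (G R : {group gT}) n (rG : mx_representation F G n.+1) (r : nat) :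
    solvable G -> mx_faithful rG -> zsigmondy_prime #|F| n.+1 r -> (0 < n)%N ->
    r.-Sylow(G) R -> R :!=: 1%g -> ~~ (R <| G) ->
  exists s a, [/\ prime s, n.+1 = s ^ a & #|R| = (s ^ a).+1]%N.
Proof.
move=> solG injG zs n_gt0 sylR ntR notnR; have [r_pr _ _] := zs.
have F_gt0 : (0 < #|F|)%N by apply/card_gt0P; exists 0.
have n_r : (n.+1 < r)%N.
  have r_gt1 := prime_gt1 r_pr; have := zsigmondy_dvd_pred F_gt0 (ltn0Sn n) zs.
  by move/(dvdn_leq _); rewrite ltn_predRL => /(_ r_gt1); case: (r) r_gt1.
have r_odd : odd r by case: (even_prime r_pr) => // r2; rewrite r2 in n_r; lia.
have [sRG rR _] := and3P sylR.
have kerG : rker rG \subset [1] := injG.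
have ker1 (L : {group gT}) (sLG : L \subset G) :
  L :!=: 1%g -> ~~ (L \subset rker (subg_repr rG sLG)).
  by apply: contra => sL; rewrite -subG1 (subset_trans sL) // rker_subg subIset //
    kerG orbT.
have irr (L : {group gT}) (sLG : L \subset G) :
  r.-group L -> L :!=: 1%g -> mx_irreducible (subg_repr rG sLG).
  by move=> rL ntL; apply: zsigmondy_mx_irr zs rL (ker1 L sLG ntL).
have injL (L : {group gT}) (sLG : L \subset G) : mx_faithful (subg_repr rG sLG).
  by rewrite /mx_faithful rker_subg subIset // kerG orbT.
have ntZ : 'Z(R) != 1%g by apply: contraNneq ntR => /(trivg_center_pgroup rR)->.
have [x Zx ox] : {x | x \in 'Z(R) & #[x] = r}.
  by apply: Cauchy => //; have [] := pgroup_pdiv (pgroupS (center_sub R) rR) ntZ.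
pose H := <[x]>; have oH : #|H| = r := ox.
have sHR : H \subset R by rewrite cycle_subG (subsetP (center_sub R)).
have sHG : H \subset G := subset_trans sHR sRG.
have rH : r.-group H := pgroupS sHR rR.
have ntH : H :!=: 1%g by rewrite -cardG_gt1 oH prime_gt1.
have prH : prime #|H| by rewrite oH.
have irrH := irr _ sHG rH ntH.
have fixH : rfix_mx rG H = 0 := mx_irr_rfix0 irrH (ker1 _ sHG ntH).
have cCC : abelian 'C_G(H) := faithful_irr_cent_abelian injG irrH (cycle_abelian x).
have sRC : R \subset 'C_G(H).
  by rewrite subsetI sRG centsC cycle_subG; have /setIP[] := Zx.
have cRR : abelian R := abelianS sRC cCC.
have cycR : cyclic R := mx_faithful_irr_abelian_cyclic (injL _ sRG) (irr _ sRG rR ntR)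
  cRR.
(* If [H] were normal, so would be the abelian group ['C_G(H)], of which [R] is the Sylow
   [r]-subgroup. *)
have notnH : ~~ (H <| G).
  apply: contra notnR => nHG.
  have nsCG : 'C_G(H) <| G by rewrite norm_normalI // norms_cent ?normal_norm.
  rewrite (nilpotent_Hall_pcore (abelian_nil cCC) (pHall_subl sRC (subsetIl _ _) sylR)).
  by rewrite gFnormal_trans.
have notHO : ~~ (H \subset 'O_r(G)).
  apply: contra notnH => sHO; apply: char_normal_trans (pcore_normal r G).
  by rewrite sub_cyclic_char // (cyclicS (pcore_sub_Hall sylR)).
(* Otherwise [H] centralizes ['F(G)], hence lies in it and so in ['O_r(G)]. The bound on [s] makes
   the search finite: for larger [s] the core is trivial. *)
have [s s_pr ncH] : exists2 s, prime s & ~~ (H \subset 'C('O_s(G))).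
  have [/existsP[s /andP[s_pr ncH]] | none] :=
    boolP [exists s : 'I_#|G|.+1, prime s && ~~ (H \subset 'C('O_s(G)))].
    by exists s.
  case/negP: notHO; rewrite -p_core_Fitting sub_Hall_pcore ?nilpotent_pcore_Hall
    ?Fitting_nil //.
  apply: subset_trans (cent_sub_Fitting solG); rewrite subsetI sHG.
  apply: prime_cent_pcore_cent_Fitting => s s_pr.
  have [le_s | lt_s] := leqP s #|G|.
    move: none; rewrite negb_exists => /forallP/(_ (inord s)).
    by rewrite inordK ?ltnS // s_pr /= negbK.
  have -> : 'O_s(G) = 1%g; last exact: cents1.
  apply/trivgP; apply: contraT; rewrite subG1.
  case/(pgroup_pdiv (pcore_pgroup s G)) => _ + _.
  move=> /dvdn_leq-/(_ (cardG_gt0 _)) le_s.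
  by have := leq_trans le_s (subset_leq_card (pcore_sub s G)); rewrite leqNgt lt_s.
have neq_sr : s != r.
  apply: contraNneq ncH => ->; apply: subset_trans sHR _.
  exact: subset_trans cRR (centS (pcore_sub_Hall sylR)).
pose K := 'O_s(G); have sK : s.-group K := pcore_pgroup s G.
have sKG : K \subset G := pcore_sub s G.
have irrG : mx_irreducible rG := subg_mx_irr irrH.
(* In characteristic [s] a faithful irreducible representation forces ['O_s(G) = 1]. *)
have s_nz : s%:R != 0 :> F.
  apply/negP=> s0; case/negP: ncH.
  by rewrite (pcore_faithful_mx_irr_pchar _ irrG injG) ?cents1 // inE s_pr.
have nKR : R \subset 'N(K) := subset_trans sRG (gFnorm _ _).
have coKR : coprime #|K| #|R|.
  by rewrite (pnat_coprime sK) // (pi_pnat rR) // !inE eq_sym.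
have solK : solvable K := solvableS sKG solG.
pose D := [~: K, H].
have nKH := subset_trans sHR nKR; have coKH := coprimegS sHR coKR.
have sDK : D \subset K by rewrite commg_subl.
have sDG := subset_trans sDK sKG; have sD : s.-group D := pgroupS sDK sK.
have ntD : D != 1%g by apply: contra ncH => /eqP/commG1P; rewrite centsC.
have nDH : H \subset 'N(D) := commg_normr H K.
have nDR : R \subset 'N(D).
  by rewrite normsR // cents_norm // (subset_trans cRR) ?centS.
have coDR := coprimeSg sDK coKR; have coDH := coprimegS sHR coDR.
have nz_card (L : {group gT}) : s.-group L -> #|L|%:R != 0 :> F.
  by move=> sL; rewrite (card_pgroup sL) natrX expf_neq0.
have [spD cDH] : special D /\ 'C_D(H) = 'Z(D).
  apply: (abelian_charsimple_special sD coDH (coprime_commGid nKH coKH solK)).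
  apply/bigcupsP=> X /andP[chX cXX]; have sXD := char_sub chX; rewrite centsC.
  apply: (prime_rfix0_cent_abelian injG (subset_trans sXD sDG) sHG fixH prH) => //.
  - exact: char_norm_trans chX nDH.
  - exact: coprimeSg sXD coDH.
  exact: nz_card (pgroupS sXD sD).
have cZH : 'Z(D) \subset 'C(H) by rewrite -cDH subsetIr.
have sZG : 'Z(D) \subset G := subset_trans (center_sub D) sDG.
(* ['Z(D) <*> H] is abelian with a faithful irreducible representation. Being also elementary
   abelian, ['Z(D)] then has order [s]. *)
have cycZ : cyclic 'Z(D).
  have sLG : 'Z(D) <*> H \subset G by rewrite join_subG sZG.
  have irrL : mx_irreducible (subg_repr rG sLG).
    exact: (@subg_mx_irr _ _ _ H _ (subg_repr rG sLG) (joing_subr _ _)).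
  apply: cyclicS (mx_faithful_irr_abelian_cyclic (injL _ sLG) irrL _).
    exact: joing_subl.
  by rewrite abelianY center_abelian cycle_abelian centsC.
have abZ : s.-abelem 'Z(D) := center_special_abelem sD spD.
have oZ : #|'Z(D)| = s.
  have ntZD : 'Z(D) != 1%g by apply: contraNneq ntD => /(trivg_center_pgroup sD)/eqP.
  have [_ dvZ _] := pgroup_pdiv (abelem_pgroup abZ) ntZD.
  have logn_gt0 : (0 < logn s #|'Z(D)|)%N by rewrite logn_gt0 mem_primes s_pr cardG_gt0.
  rewrite (card_pgroup (abelem_pgroup abZ)) (_ : logn _ _ = 1%N) //.
  by apply/eqP; rewrite eqn_leq logn_gt0 -(abelem_cyclic abZ) cycZ.
have [a a_gt0 oD] := card_extraspecial sD (conj spD (etrans (congr1 prime oZ) s_pr)).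
have iDZ : #|D : 'Z(D)| = ((s ^ a) ^ 2)%N.
  apply/eqP; rewrite -(eqn_pmul2l (cardG_gt0 'Z(D))) Lagrange ?center_sub // oD oZ.
  by rewrite -expnM muln2 expnS.
have sa_le : (s ^ a <= n.+1)%N.
  rewrite -(@leq_exp2r _ _ 2) // -iDZ (index_center_leq injG irrH sDG) //.
  by have [_ ->] := spD.
have nZR : R \subset 'N('Z(D)) := char_norm_trans (center_char D) nDR.
have coZR : coprime #|'Z(D)| #|R| := coprimeSg (center_sub D) coDR.
(* Since [R] is cyclic, every nontrivial [<[y]>] contains [H]; by coprimality the fixed points of
   [y] on [D / 'Z(D)] come from ['C_D(y)], inside ['C_D(H) = 'Z(D)]. *)
have regR : semiregular (D / 'Z(D)) (R / 'Z(D)).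
  move=> yb /setD1P[ntyb /morphimP[y Ny Ry Dyb]].
  have nty : y != 1%g by apply: contraNneq ntyb => y1; rewrite Dyb y1 morph1.
  have syR : <[y]> \subset R by rewrite cycle_subG.
  have sHy : H \subset <[y]>.
    have [_ r_y _] := pgroup_pdiv (pgroupS syR rR) (etrans (congr1 negb (cycle_eq1 y))
      nty).
    have [u yu ou] := Cauchy r_pr r_y.
    have syu : <[u]> \subset <[y]> by rewrite cycle_subG.
    have /eqP -> // : H == <[u]>%G :> {set gT}.
    by rewrite (eq_subG_cyclic cycR sHR (subset_trans syu syR)) oH [#|_|]ou.
  apply/trivgP; rewrite Dyb /= -cent_cycle -quotient_cycle //.
  rewrite -(coprime_quotient_cent (center_sub D) (subset_trans syR nZR)).
  - rewrite -(trivg_quotient 'Z(D)) quotientS //=.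
    by apply: subset_trans (setIS _ (centS sHy)) _; rewrite cDH.
  - exact: coprimegS syR coDR.
  exact: solvableS sDK solK.
have dvdR : (#|R| %| ((s ^ a) ^ 2).-1)%N.
  rewrite -iDZ -card_quotient ?gFnorm // (card_isog (quotient_isog nZR (coprime_TIg
    coZR))).
  exact: regular_norm_dvd_pred (quotient_norms _ nDR) regR.
have r_le : (r <= #|R|)%N by rewrite -oH subset_leq_card.
have N_gt1 : (1 < s ^ a)%N by rewrite -(expn0 s) ltn_exp2l // prime_gt1.
have [e oR] : exists e, #|R| = (r ^ e)%N by exists (logn r #|R|); apply: card_pgroup.
exists s, a; move: dvdR; rewrite oR => /(pexp_dvd_pred_sqr r_pr r_odd N_gt1).
(* The divisor [s ^ a - 1 <= n] is too small; the other gives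
   [#|R| <= s ^ a + 1 <= n + 2 <= r <= #|R|], so all are equal. *)
rewrite -oR => /orP[] /dvdn_leq le_R.
  have := leq_trans r_le (le_R _); rewrite ltn_predRL N_gt1 => /(_ isT).
  by move: n_r sa_le; clear; lia.
have := leq_trans r_le (le_R isT); have := le_R isT.
by move: n_r sa_le r_le; clear -s_pr; split => //; lia.
Qed.

End Representations.

(** * The arithmetic of q^m + 1 *)

Lemma zsigmondy_dvd_half q m r : 0 < q -> 0 < m ->
  zsigmondy_prime q (2 * m) r -> r %| q ^ m + 1.
Proof.
move=> q_gt0 m_gt0 [r_pr r_dv r_min].
have r_ndv : ~~ (r %| q ^ m - 1) by apply: r_min; rewrite m_gt0 ltn_Pmull.
move: r_dv; rewrite mulnC expnM -[X in _ - X](exp1n 2) subn_sqr Euclid_dvdM //.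
by rewrite (negbTE r_ndv).
Qed.

(** A proper divisor of the 2-power [2 * m] divides [m], so a smaller exponent [j] would make [r]
    divide both [q ^ m - 1] and [q ^ m + 1], hence 2. *)
Lemma odd_dvd_half_zsigmondy q m r : 1 < q -> 0 < m -> 2.-nat m ->
  prime r -> odd r -> r %| q ^ m + 1 -> zsigmondy_prime q (2 * m) r.
Proof.
move=> q_gt1 m_gt0 m2 r_pr r_odd r_dv; have q_gt0 := ltnW q_gt1.
have r_n : r %| q ^ (2 * m) - 1.
  by rewrite mulnC expnM -[X in _ - X](exp1n 2) subn_sqr dvdn_mull.
split=> // j /andP[j_gt0 lt_j]; apply/negP=> r_j.
have rd := dvdn_subX1_gcd q_gt0 r_j r_n.
have d_m : gcdn j (2 * m) %| m.
  have [k Dm] := p_natP m2; have Dm2 : 2 * m = 2 ^ k.+1 by rewrite Dm expnS.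
  have := dvdn_gcdr j (2 * m); have := dvdn_leq j_gt0 (dvdn_gcdl j (2 * m)).
  rewrite Dm2 => le_dj /dvdn_pfactor[] // i le_i Di; rewrite Di in le_dj *.
  rewrite Dm dvdn_exp2l // -ltnS ltn_neqAle le_i andbT.
  by apply: contraTneq lt_j => Di'; rewrite Dm2 -Di' -leqNgt.
have [c Dm] := dvdnP d_m; have := dvdn_subX1_mull c q_gt0 rd; rewrite -Dm.
move/(dvdn_sub r_dv); rewrite subnBA ?expn_gt0 ?q_gt0 // -addnA addKn.
by rewrite dvdn_prime2 // => /eqP r2; rewrite r2 in r_odd.
Qed.

Lemma zsigmondy_large q m : odd q -> 1 < q -> 1 < m -> ~ (q = 3 /\ m = 2) ->
  exists r, zsigmondy_prime q (2 * m) r /\ (2.-nat m -> (2 * m).+1 < (q ^ m + 1)`_r).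
Proof.
move=> q_odd q_gt1 m_gt1 not32; have m_gt0 := ltnW m_gt1.
have q_gt2 : 2 < q by rewrite odd_gt2.
have [m2 | m_not2] := boolP (2.-nat m); last first.
  have [| |r zs] := @zsigmondy_exists q (2 * m) q_gt2.
    by rewrite mul2n -addnn ltn_addl.
    by rewrite pnatM /= m_not2.
  by exists r; split=> //; rewrite (negbTE m_not2).
have [k Dm] := p_natP m2; have k_gt0 : 0 < k by case: k Dm m_gt1 => // ->.
(* As [m] is even, [q ^ m] is the square of the odd number [y], so [q ^ m + 1] is twice an odd
   number [w]. *)
pose y := q ^ (2 ^ k.-1); have y_odd : odd y by rewrite oddX q_odd orbT.
have Dq : q ^ m = y ^ 2 by rewrite -expnM -expnSr prednK // -Dm.
pose w := (y ^ 2)./2.+1; 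
have DN : q ^ m + 1 = 2 * w.
  rewrite Dq /w -[in LHS](odd_double_half (y ^ 2)) oddX y_odd -mul2n.
  by move: (_ ./2) => h; clear; lia.
have w_odd : odd w.
  have Dy : y = (2 * y./2).+1 by rewrite -[LHS]odd_double_half y_odd mul2n.
  rewrite /w /= -mulnn; move: (y./2) Dy => h ->.
  rewrite (_ : _ * _ = (2 * (h * h + h)).*2.+1); last by rewrite -!mul2n; ring.
  by rewrite /= uphalf_double oddM.
have w_gt1 : 1 < w.
  rewrite /w ltnS half_gt0 -(expn1 2); apply: leq_trans (_ : 3 ^ 2 <= _) => //.
  by rewrite leq_exp2r // odd_gt2 // /y -(expn0 q) ltn_exp2l // expn_gt0.
have zs_w u : prime u -> u %| w -> zsigmondy_prime q (2 * m) u.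
  move=> u_pr u_w; apply: odd_dvd_half_zsigmondy => //; first exact: dvdn_odd u_w w_odd.
  by rewrite DN dvdn_mull.
have [/hasP[u] | /hasPn small] := boolP (has (fun u : nat => (2 * m).+1 < (q ^ m +
  1)`_u) (primes w)).
  by rewrite mem_primes => /and3P[u_pr _ u_w] lt_u; exists u; split=> //; apply: zs_w.
case: not32.
(* Here [2 * m] divides [u - 1], so [u >= 2 * m + 1], which [small] makes an upper bound for the
   [u]-part. Thus [w] has a single prime divisor, occurring once. *)
have part_w u : prime u -> u %| w -> u = (2 * m).+1 /\ w`_u = u.
  move=> u_pr u_w; have := small u; rewrite mem_primes u_pr u_w (ltnW w_gt1) -leqNgt =>
    /(_ isT).
  have u_odd : odd u := dvdn_odd u_w w_odd.
  rewrite DN partnM ?(ltnW w_gt1) // part_p'nat ?mul1n; last first.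
    by rewrite pnatE // !inE; apply: contraTneq u_odd => <-.
  have := zsigmondy_dvd_pred (ltnW q_gt1) (_ : 0 < 2 * m) (zs_w u u_pr u_w).
  rewrite muln_gt0 m_gt0 => /(_ isT)/dvdn_leq;
    rewrite ltn_predRL prime_gt1 // => /(_ isT) le_m.
  have : u <= w`_u by rewrite dvdn_leq ?part_gt0 //
    -{1}(part_pnat_id (pnat_id u_pr)) partn_dvd ?(ltnW w_gt1).
  by move: (prime_gt1 u_pr) le_m; move: (w`_u) => wu; clear; lia.
pose u := pdiv w; have u_pr : prime u := pdiv_prime w_gt1.
have [Du wu] := part_w u u_pr (pdiv_dvd w).
have Dw : w = (2 * m).+1.
  rewrite -Du -wu part_pnat_id //; apply/pnatP=> [|v v_pr v_w]; first exact: ltnW.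
  by rewrite inE Du; have [-> _] := part_w v v_pr v_w.
have Dqm : q ^ m = 4 * m + 1 by move: DN; rewrite Dw; move: (q ^ m) => N; clear; lia.
(* For [m >= 3] already [3 ^ m] exceeds [4 * m + 1]. *)
have m_le2 : m <= 2.
  rewrite leqNgt; apply/negP=> m_gt2.
  have : 3 ^ m <= 4 * m + 1 by rewrite -Dqm leq_exp2r.
  rewrite -(subnK m_gt2); elim: (m - 3) => [|i IHi] //.
  rewrite addSn expnS; by move: IHi; move: (3 ^ _) => N; clear; lia.
have {}m_le2 : m = 2 by apply/eqP; rewrite eqn_leq m_le2.
split=> //; move: Dqm; rewrite m_le2 (_ : 4 * 2 + 1 = 3 ^ 2) // => /eqP.
by rewrite eqn_exp2r // => /eqP.
Qed.

Theorem theorem2p16 (p k q m : nat) (F : finFieldType)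
    (B : {biscalar 'rV[F]_(2 * m).-1.+1}%R) (G : {group {'GL_(2 * m)[F]}})
    (p_prime : prime p) (p_odd : odd p) (k_gt0 : 0 < k) (q_def : q = p ^ k)
    (cardF : #|F| = q)
    (m_ge2 : 2 <= m)
    (q_or_m : q = 1 %[mod 4] \/ ~~ odd m)
    (B_alt : alternating B) (B_nondeg : nondegenerate_form B)
    (G_sub : G \subset isometry_group B)
    (G_sol : solvable G)
    (G_card : q ^ m + 1 %| #|G|)
    (not_exception : ~ (q = 3 /\ m = 2)) :
  exists r : nat, zsigmondy_prime q (2 * m) r /\
    exists P : {group {'GL_(2 * m)[F]}}, (r.-Sylow(G) P)%g /\ (P <| G)%g.
Proof.
have q_odd : odd q by rewrite q_def oddX p_odd orbT.
have q_gt1 : 1 < q by rewrite q_def -(expn0 p) ltn_exp2l // prime_gt1.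
have q_gt0 := ltnW q_gt1; have m_gt0 := ltnW m_ge2.
have Dn : (2 * m).-1.+1 = 2 * m by rewrite prednK // muln_gt0.
have [r [zs r_large]] := zsigmondy_large q_odd q_gt1 m_ge2 not_exception.
have [r_pr _ _] := zs; exists r; split=> //.
have [P sylP] := Sylow_exists r G; exists P; split=> //.
apply: contraT => not_nPG.
have reprG : mx_repr G (fun g : {'GL_(2 * m)[F]} => val g) by [].
have injG : mx_faithful (MxRepresentation reprG).
  by apply/subsetP=> g; rewrite !inE mul1mx => /andP[_].
have oP : #|P| = #|G|`_r := card_Hall sylP.
have r_G : r %| #|G| := dvdn_trans (zsigmondy_dvd_half q_gt0 m_gt0 zs) G_card.
have ntP : P :!=: 1%g.
  by rewrite -cardG_gt1 oP p_part_gt1 mem_primes r_pr cardG_gt0.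
have [|| s [a [s_pr Ds oP']]] := non_normal_Sylow_card G_sol injG _ _ sylP ntP not_nPG.
- by rewrite cardF Dn.
- by rewrite -ltnS Dn mul2n -addnn ltn_addl.
(* The dimension [2 * m = s ^ a] is even. *)
rewrite Dn in Ds; have s2 : s = 2.
  have : 2 %| s ^ a by rewrite -Ds dvdn_mulr.
  by rewrite Euclid_dvdX // dvdn_prime2 // => /andP[/eqP].
have m2 : 2.-nat m.
  have : 2.-nat (2 * m) by rewrite Ds s2 pnatX.
  by rewrite pnatM => /andP[].
(* The [r]-part of [q ^ m + 1] divides that of [#|G|], which is [#|P| = 2 * m + 1]. *)
have := r_large m2; rewrite ltnNge Ds -oP' oP dvdn_leq ?part_gt0 //.
by rewrite partn_dvd ?cardG_gt0.
Qed.
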